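(* Let $\mathbf{k}$ be a field, let $M:\mathbb{R}^2\to\mathbf{vec}$ be an $S$-constructible bimodule, with rank invariant $\mathrm{rank}_M$ and (horizontal) meta-rank $\mathbf{mrk}_M$. Then one can compute $\mathrm{rank}_M$ from $\mathbf{mrk}_M$, and one can compute $\mathbf{mrk}_M$ from $\mathrm{rank}_M$; that is, each of the two functions determines the other (for constructible bimodules $M,N:\mathbb{R}^2\to\mathbf{vec}$, $\mathrm{rank}_M=\mathrm{rank}_N$ if and only if $\mathbf{mrk}_M=\mathbf{mrk}_N$). In particular, for all $(s,y)\le(t,y')$ in $\mathbb{R}^2$, $$\mathrm{rank}_M((s,y),(t,y'))=\#\{[b_i,d_i)\in \mathrm{barc}(\mathbf{mrk}_M([s,\overline{S}_>(t))))\ :\ b_i\le y\le y'<d_i\},$$ i.e. the rank is the number of intervals, counted with multiplicity, in $\mathrm{barc}(\mathbf{mrk}_M([s,\overline{S}_>(t))))$ that contain $[y,y']$.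
   Context: Fix a field $\mathbf{k}$; $\mathbf{vec}$ is the category of finite-dimensional $\mathbf{k}$-vector spaces. A persistence module over a poset $P$ is a functor $M:P\to\mathbf{vec}$, with internal maps $\varphi_M(p\le q):M(p)\to M(q)$; a bimodule is a persistence module over $\mathbb{R}^2$ with the product order. The rank invariant is $\mathrm{rank}_M(a,b):=\mathrm{rank}(\varphi_M(a\le b))$ for $a\le b$. Constructibility. Let $S=\{s_1<\dots<s_n\}\subset\mathbb{R}$ be finite, and set $s_{n+1}:=\infty$ for this definition. $M:\mathbb{R}\to\mathbf{vec}$ is $S$-constructible if $M(a)=0$ for $a<s_1$ and $\varphi_M(a\le b)$ is an isomorphism whenever $s_i\le a\le b<s_{i+1}$, $1\le i\le n$. A bimodule $M$ is $S$-constructible if $M((x,y))=0$ whenever $x<s_1$ or $y<s_1$, and $\varphi_M((x_1,y_1)\le(x_2,y_2))$ is an isomorphism whenever $s_i\le x_1\le x_2<s_{i+1}$ and $s_j\le y_1\le y_2<s_{j+1}$, $1\le i,j\le n$. A module is constructible if it is $S$-constructible for some finite nonempty $S$. All modules are assumed constructible. A constructible module over $\mathbb{R}$ is determined up to isomorphism by its barcode $\mathrm{barc}(M)$, the multiset of intervals $I$ (of the form $[b,d)$ with $b\in\mathbb{R}$, $d\in\mathbb{R}\cup\{\infty\}$) with $M\cong\bigoplus_{I\in\mathrm{barc}(M)}\mathbf{k}^I$, where $\mathbf{k}^I$ is the interval module. $\mathbf{Pvec}$ denotes the set of isomorphism classes $[M]$ of such persistence modules over $\mathbb{R}$. $\mathrm{Dgm}$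 is the poset, ordered by inclusion, of all intervals $[p,q)$ with $p<q$ in $\mathbb{R}$ and all $[p,\infty)$, $p\in\mathbb{R}$. For a bimodule $M$ and $s\in\mathbb{R}$, the vertical slice $M_x^s:\mathbb{R}\to\mathbf{vec}$ is $M_x^s(a)=M((s,a))$ with internal maps $\varphi_M((s,a)\le(s,b))$. For $s\le t$, the morphism $\phi_x(s\le t):M_x^s\to M_x^t$ is $\phi_x(s\le t)(a):=\varphi_M((s,a)\le(t,a))$. Meta-rank. For $S$-constructible $M$, $\mathbf{mrk}_M:\mathrm{Dgm}\to\mathbf{Pvec}$ is defined by: for $I=[s,s_i)$ with $s_i\in S$, $\mathbf{mrk}_M(I):=[\mathrm{im}(\phi_x(s\le s_i-\delta))]$ for some $\delta>0$ with $s_i-\delta\ge s$ and $s_i-\delta\ge s_{i-1}$ ($s_0$ being any value less than $s_1$); for $I=[s,\infty)$, $\mathbf{mrk}_M(I):=[\mathrm{im}(\phi_x(s\le\max(s,s_n)))]$; for all other $I=[s,t)$, $\mathbf{mrk}_M(I):=[\mathrm{im}(\phi_x(s\le t))]$. Let $\overline{S}:=S\cup\{\infty\}$ and, for $t\in\mathbb{R}$, $\overline{S}_>(t):=\min\{s\in\overline{S}: s>t\}$. *)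

(* Defs.v *)
From HB Require Import structures.
From mathcomp Require Import all_boot all_order all_algebra.
From mathcomp Require Import finmap multiset.
From mathcomp Require Import all_classical all_reals ereal.

Set Implicit Arguments.
Unset Strict Implicit.
Unset Printing Implicit Defensive.

Import Order.TTheory GRing.Theory Num.Theory.
Local Open Scope classical_set_scope.
Local Open Scope ring_scope.

Section Modules.
Context (k : fieldType) (d : Order.disp_t) (P : porderType d).

Record pmod := PMod {
  pobj :> P -> vectType k;
  pmap : forall p q : P, (p <= q)%O -> 'Hom(pobj p, pobj q);
  pmap_id : forall p (h : (p <= p)%O), pmap h = \1%VF;
  pmap_comp : forall p q r (hpq : (p <= q)%O) (hqr : (q <= r)%O)
    (hpr : (p <= r)%O), pmap hpr = (pmap hqr \o pmap hpq)%VF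
}.

Record pmor (M N : pmod) := PMor {
  pmor_fun :> forall p, 'Hom(M p, N p);
  pmor_nat : forall p q (h : (p <= q)%O),
    (pmor_fun q \o pmap M h)%VF = (pmap N h \o pmor_fun p)%VF
}.

Definition lfun_iso (U V : vectType k) (f : 'Hom(U, V)) : Prop :=
  exists g : 'Hom(V, U), (g \o f = \1)%VF /\ (f \o g = \1)%VF.

Definition pmod_iso (M N : pmod) : Prop :=
  exists (f : pmor M N) (g : pmor N M),
    forall p, (g p \o f p = \1)%VF /\ (f p \o g p = \1)%VF.

Definition rank (M : pmod) (a b : P) (h : (a <= b)%O) : nat :=
  \dim (limg (pmap M h)).

Section Image.
Context (M N : pmod) (f : pmor M N).

Definition im_obj (p : P) : vectType k := subvs_of (limg (f p)).

Definition im_map p q (h : (p <= q)%O) : 'Hom(im_obj p, im_obj q) :=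
  (linfun (vsproj (limg (f q))) \o pmap N h \o linfun vsval)%VF.

Lemma im_mapE p q (h : (p <= q)%O) (u : im_obj p) :
  vsval (im_map h u) = pmap N h (vsval u).
Proof.
rewrite /im_map !comp_lfunE !lfunE /= vsprojK //.
have /memv_imgP [x _ ->] := subvsP u.
by rewrite -comp_lfunE -pmor_nat comp_lfunE memv_img ?memvf.
Qed.

Fact im_map_id p (h : (p <= p)%O) : im_map h = \1%VF.
Proof.
by apply/lfunP => u; apply: val_inj; rewrite /= im_mapE pmap_id !lfunE.
Qed.

Fact im_map_comp p q r (hpq : (p <= q)%O) (hqr : (q <= r)%O) (hpr : (p <= r)%O) :
  im_map hpr = (im_map hqr \o im_map hpq)%VF.
Proof.
apply/lfunP => u; apply: val_inj.
by rewrite /= comp_lfunE !im_mapE (pmap_comp _ hpq hqr hpr) comp_lfunE.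
Qed.

Definition im_pmod : pmod := PMod im_map_id im_map_comp.

End Image.

Section DirectSum.

Definition zero_obj (p : P) : vectType k := 'rV[k]_0.

Definition zero_map p q (_ : (p <= q)%O) : 'Hom(zero_obj p, zero_obj q) := \1%VF.

Fact zero_map_id p (h : (p <= p)%O) : zero_map h = \1%VF.
Proof. by []. Qed.

Fact zero_map_comp p q r (hpq : (p <= q)%O) (hqr : (q <= r)%O) (hpr : (p <= r)%O) :
  zero_map hpr = (zero_map hqr \o zero_map hpq)%VF.
Proof. by rewrite comp_lfun1l. Qed.

Definition zero_pmod : pmod := PMod zero_map_id zero_map_comp.

Definition pair_fun (U V U' V' : vectType k) (f : 'Hom(U, U'))
  (g : 'Hom(V, V')) (w : U * V) : U' * V' := (f w.1, g w.2).

Fact pair_fun_linear (U V U' V' : vectType k) (f : 'Hom(U, U')) (g : 'Hom(V, V')) :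
  linear (pair_fun f g).
Proof. by move=> a w w'; rewrite /pair_fun /= !linearP. Qed.

HB.instance Definition _ (U V U' V' : vectType k) (f : 'Hom(U, U'))
  (g : 'Hom(V, V')) := GRing.isLinear.Build k (U * V)%type (U' * V')%type _
    (pair_fun f g) (pair_fun_linear f g).

Context (M N : pmod).

Definition dsum_obj (p : P) : vectType k := (M p * N p)%type.

Definition dsum_map p q (h : (p <= q)%O) : 'Hom(dsum_obj p, dsum_obj q) :=
  linfun (pair_fun (pmap M h) (pmap N h)).

Fact dsum_map_id p (h : (p <= p)%O) : dsum_map h = \1%VF.
Proof.
by apply/lfunP => -[u v]; rewrite !lfunE /= /pair_fun !pmap_id !lfunE.
Qed.

Fact dsum_map_comp p q r (hpq : (p <= q)%O) (hqr : (q <= r)%O) (hpr : (p <= r)%O) :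
  dsum_map hpr = (dsum_map hqr \o dsum_map hpq)%VF.
Proof.
apply/lfunP => -[u v]; rewrite comp_lfunE !lfunE /= /pair_fun /=.
by rewrite !(pmap_comp _ hpq hqr hpr) !comp_lfunE.
Qed.

Definition dsum_pmod : pmod := PMod dsum_map_id dsum_map_comp.

End DirectSum.

End Modules.

Section Intervals.
Context (R : realType).

(* [(b, d)] with [b%:E < d] stands for [b, d), where [d] is real or [+oo]. *)
Record Dgm := MkDgm { dgmval : R * \bar R; dgmP : (dgmval.1%:E < dgmval.2)%E }.

HB.instance Definition _ := [isSub for dgmval].
HB.instance Definition _ := [Choice of Dgm by <:].

Definition inI (I : Dgm) (a : R) : bool :=
  ((dgmval I).1 <= a) && (a%:E < (dgmval I).2)%E.

Lemma inI_convex I (a b c : R) : a <= b -> b <= c ->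
  inI I a -> inI I c -> inI I b.
Proof.
move=> ab bc /andP[Ia _] /andP[_ Ic]; rewrite /inI (le_trans Ia ab) /=.
by apply: le_lt_trans Ic; rewrite lee_fin.
Qed.

End Intervals.

Section IntervalModule.
Context (k : fieldType) (R : realType) (I : Dgm R).

(* The dimension is [inI I a : bool] read as 0 or 1; the all-ones matrix is the
   identity when both endpoints are in [I], and an empty matrix otherwise. *)
Definition int_obj (a : R) : vectType k := 'rV[k]_(inI I a).

Definition int_map (a b : R) (_ : a <= b) : 'Hom(int_obj a, int_obj b) :=
  linfun (mulmxr (const_mx 1 : 'M[k]_(inI I a, inI I b))).

Fact int_map_id a (h : a <= a) : int_map h = \1%VF.
Proof.
apply/lfunP => u; rewrite !lfunE /=; move: u; rewrite /int_obj.
case: (inI I a) => u; last by apply/rowP => -[].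
rewrite -[RHS]mulmx1; congr (_ *m _).
by apply/matrixP => i j; rewrite !mxE !ord1.
Qed.

Fact int_map_comp a b c (hab : a <= b) (hbc : b <= c) (hac : a <= c) :
  int_map hac = (int_map hbc \o int_map hab)%VF.
Proof.
apply/lfunP => u; rewrite comp_lfunE !lfunE /= -mulmxA; congr (_ *m _).
have := @inI_convex _ I _ _ _ hab hbc.
case: (inI I a) => [|_]; last by apply/matrixP => -[].
case: (inI I c) => [|_]; last by apply/matrixP => i [].
case: (inI I b) => [_|/(_ isT isT)//].
by apply/matrixP => i j; rewrite !mxE big_ord1 !mxE mulr1.
Qed.

Definition int_pmod : pmod k R := PMod int_map_id int_map_comp.

End IntervalModule.

Section Constructible.
Context (k : fieldType) (R : realType).

Record critset := Critset {
  critseq :> seq R;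
  crit_sorted : sorted <%R critseq;
  crit_neq0 : critseq != [::]
}.

(* Indices start at 0: [crit S i] is s_(i+1), and [+oo] when [i >= n]. *)
Definition crit (S : critset) (i : nat) : \bar R :=
  nth +oo%E [seq s%:E | s <- S] i.

Definition S_constructible (S : critset) (M : pmod k R) : Prop :=
  (forall a : R, (a%:E < crit S 0)%E -> \dim {: M a} = 0%N) /\
  (forall (i : nat) (a b : R) (h : a <= b), (i < size S)%N ->
    (crit S i <= a%:E)%E -> (b%:E < crit S i.+1)%E -> lfun_iso (pmap M h)).

Definition constructible (M : pmod k R) : Prop :=
  exists S : critset, S_constructible S M.

Definition bimodule := pmod k (R *p R)%type.

Definition pt (x y : R) : (R *p R)%type := (x, y).

Definition S_biconstructible (S : critset) (M : bimodule) : Prop :=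
  (forall x y : R, (x%:E < crit S 0)%E \/ (y%:E < crit S 0)%E ->
    \dim {: M (pt x y)} = 0%N) /\
  (forall (i j : nat) (x1 x2 y1 y2 : R) (h : (pt x1 y1 <= pt x2 y2)%O),
    (i < size S)%N -> (j < size S)%N ->
    (crit S i <= x1%:E)%E -> x1 <= x2 -> (x2%:E < crit S i.+1)%E ->
    (crit S j <= y1%:E)%E -> y1 <= y2 -> (y2%:E < crit S j.+1)%E ->
    lfun_iso (pmap M h)).

Definition iso_class (M : pmod k R) : pmod k R -> Prop := fun N => pmod_iso M N.

Record Pvec := MkPvec {
  pvec_set :> pmod k R -> Prop;
  pvecP : exists M, constructible M /\ pvec_set = iso_class M
}.

Definition pvec_of (M : pmod k R) (hM : constructible M) : Pvec :=
  MkPvec (ex_intro _ M (conj hM erefl)).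

Definition barsum (B : {mset Dgm R}%mset) : pmod k R :=
  foldr (fun I => dsum_pmod (int_pmod k I)) (zero_pmod k R) (enum_mset B).

(* The interval decomposition of a constructible module exists and is unique;
   [mset0] would only be returned for a class without any decomposition. *)
Definition barc (C : Pvec) : {mset Dgm R}%mset :=
  xget mset0%mset [set B : {mset Dgm R}%mset | pvec_set C (barsum B)].

End Constructible.

Section Slices.
Context (k : fieldType) (R : realType) (M : bimodule k R).

Lemma pt_le (x1 x2 y1 y2 : R) : x1 <= x2 -> y1 <= y2 ->
  (pt x1 y1 <= pt x2 y2)%O.
Proof. by move=> hx hy; rewrite leEprod /= hx hy. Qed.

Lemma pt_le1 (x1 x2 y1 y2 : R) : (pt x1 y1 <= pt x2 y2)%O -> x1 <= x2.
Proof. by rewrite leEprod => /andP[]. Qed.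

Definition slice_map (s a b : R) (h : a <= b) : 'Hom(M (pt s a), M (pt s b)) :=
  pmap M (pt_le (lexx s) h).

Fact slice_map_id s a (h : a <= a) : slice_map s h = \1%VF.
Proof. exact: pmap_id. Qed.

Fact slice_map_comp s a b c (hab : a <= b) (hbc : b <= c) (hac : a <= c) :
  slice_map s hac = (slice_map s hbc \o slice_map s hab)%VF.
Proof. exact: pmap_comp. Qed.

Definition slice (s : R) : pmod k R :=
  @PMod k _ R (fun a => M (pt s a)) (slice_map s)
    (slice_map_id s) (@slice_map_comp s).

Definition phix_fun (s t : R) (h : s <= t) (a : R) : 'Hom(slice s a, slice t a) :=
  pmap M (pt_le h (lexx a)).

Fact phix_nat s t (h : s <= t) (a b : R) (hab : a <= b) :
  (phix_fun h b \o pmap (slice s) hab)%VF = (pmap (slice t) hab \o phix_fun h a)%VF.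
Proof. by rewrite -!(pmap_comp _ _ _ (pt_le h hab)). Qed.

Definition phix (s t : R) (h : s <= t) : pmor (slice s) (slice t) :=
  PMor (phix_nat h).

End Slices.

Section MetaRank.
Context (k : fieldType) (R : realType) (S : critset R).

(* For i = 0 there is no lower bound besides [s], as s_0 is arbitrary. *)
Definition admissible_delta (s : R) (i : nat) : set R :=
  [set delta : R | 0 < delta /\ s <= nth 0 S i - delta /\
    ((0 < i)%N -> nth 0 S i.-1 <= nth 0 S i - delta)].

Lemma admissible_delta_ex (s : R) (i : nat) : (i < size S)%N -> s < nth 0 S i ->
  exists delta, admissible_delta s i delta.
Proof.
move=> iS si.
pose p := if i is j.+1 then nth 0 S j else s.
have pi : p < nth 0 S i.
  rewrite /p; case: i iS si @p => [//|j] jS _ p.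
  exact: (@sorted_ltn_nth _ _ lt_trans 0 _ (crit_sorted S) j j.+1 (ltnW jS) jS).
exists (nth 0 S i - Num.max s p); split; first by rewrite subr_gt0 gt_max si pi.
rewrite subKr le_max lexx; split => // i0.
by rewrite le_max /p; case: i i0 {iS si pi p} => // j _; rewrite lexx orbT.
Qed.

(* The right index of the morphism whose image is taken on [I]: for [s, s_i) it
   is [s_i - delta] for an arbitrary admissible [delta], picked by [xget]; the
   last branch is [s, +oo), as [-oo] is excluded by [dgmP]. *)
Definition mrk_end (I : Dgm R) : R :=
  let s := (dgmval I).1 in
  match (dgmval I).2 with
  | EFin t => if t \in critseq S
            then t - xget 0 (admissible_delta s (index t S))
            else t
  | _ => Num.max s (last 0 S)
  end.

Lemma mrk_end_ge (I : Dgm R) : (dgmval I).1 <= mrk_end I.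
Proof.
rewrite /mrk_end; case: I => -[s [t| |]] /= hI; rewrite ?le_max ?lexx //.
rewrite lte_fin in hI; case: ifP => tS; last exact: ltW.
have tn : nth 0 S (index t S) = t by rewrite nth_index.
have iS : (index t S < size S)%N by rewrite index_mem.
have st : s < nth 0 S (index t S) by rewrite tn.
have [_ [+ _]] := xgetPex 0 (admissible_delta_ex iS st).
by rewrite tn.
Qed.

Context (M : bimodule k R).

Lemma lfun_iso_inj (U V : vectType k) (f : 'Hom(U, V)) : lfun_iso f -> injective f.
Proof.
by move=> [g [gf _]] u v /(congr1 g); rewrite -!comp_lfunE gf !lfunE.
Qed.

Lemma lfun_iso_bij (U V : vectType k) (f : 'Hom(U, V)) :
  injective f -> (forall v, exists u, f u = v) -> lfun_iso f.
Proof.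
move=> finj fsurj; exists f^-1%VF; split; first by exact/lker0_compVf/lker0P.
apply/lfunP => v; have [u <-] := fsurj v.
by rewrite comp_lfunE lker0_lfunK ?lfunE //; exact/lker0P.
Qed.

Context (hM : S_biconstructible S M).

Lemma crit_ge0 (x : R) : (x%:E < crit S 0)%E \/
  exists2 i, (i < size S)%N & (crit S i <= x%:E)%E /\ (x%:E < crit S i.+1)%E.
Proof.
case: (ltP x%:E (crit S 0)) => h0; [by left|right].
have ex : exists i, (i <= size S)%N && (x%:E < crit S i)%E.
  by exists (size S); rewrite leqnn /crit nth_default ?size_map ?ltry.
case: (ex_minnP ex) => -[|i] /andP[iS xi] mini; first by rewrite ltNge h0 in xi.
exists i => //; split => //; rewrite leNgt; apply/negP => xi'.
by have := mini i; rewrite xi' (ltnW iS) ltnn => /(_ isT).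
Qed.

Lemma im_phix_constructible (s t : R) (h : s <= t) :
  S_constructible S (im_pmod (phix M h)).
Proof.
case: hM => hz hi; split=> [a a0|i a b hab iS ia bi].
  apply/eqP; rewrite dimvf -leqn0 /=.
  rewrite -[X in (_ <= X)%N](hz t a (or_intror a0)).
  exact: dimvS (subvf _).
have slice_iso x : lfun_iso (pmap (slice M x) hab).
  have [x0|[j jS [jx xj]]] := crit_ge0 x; last exact: (hi j i).
  have z y (u : M (pt x y)) : u = 0.
    apply/eqP; rewrite -memv0.
    suff -> : (0 = fullv :> {vspace M (pt x y)})%VS by exact: memvf.
    by apply/esym/eqP; rewrite -dimv_eq0 (hz x y (or_introl x0)).
  apply: lfun_iso_bij => [u v _|v]; first by rewrite (z _ u) (z _ v).
  by exists 0; rewrite linear0 (z _ v).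
have imE (w : im_pmod (phix M h) a) :
    vsval (pmap (im_pmod (phix M h)) hab w) = pmap (slice M t) hab (vsval w).
  exact: im_mapE.
apply: lfun_iso_bij => [u v uv|v].
  apply/val_inj/(lfun_iso_inj (slice_iso t)).
  by rewrite -[LHS]imE uv [LHS]imE.
have /memv_imgP[w _ vw] := subvsP v.
have [g [_ fg]] := slice_iso s.
pose u := phix M h a (g w).
have uin : u \in limg (phix M h a) by rewrite memv_img ?memvf.
exists (vsproj _ u); apply: val_inj; rewrite [LHS]imE vsprojK // /u.
rewrite -comp_lfunE -pmor_nat comp_lfunE.
by rewrite -[pmap _ _ _]comp_lfunE fg lfunE.
Qed.

Definition mrk (I : Dgm R) : Pvec k R :=
  pvec_of (ex_intro _ S (im_phix_constructible (mrk_end_ge I))).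

End MetaRank.

Section SuccessorInterval.
Context (R : realType) (S : critset R).
Local Open Scope ereal_scope.

Definition Sbar_gt (t : R) : \bar R :=
  \big[Order.min/+oo]_(s <- critseq S | (t < s)%R) s%:E.

Lemma Sbar_gtP (t : R) : t%:E < Sbar_gt t.
Proof.
rewrite /Sbar_gt; elim/big_ind: _ => [|x y hx hy|s ts]; rewrite ?ltry ?lte_fin //.
by rewrite lt_min hx hy.
Qed.

Definition next_interval (s t : R) (h : (s <= t)%R) : Dgm R :=
  @MkDgm R (s, Sbar_gt t)
    (le_lt_trans (h : s%:E <= t%:E) (Sbar_gtP t)).

End SuccessorInterval.

(* Main.v *)
Require Import Defs.
From HB Require Import structures.
From mathcomp Require Import all_boot all_order all_algebra.
From mathcomp Require Import finmap multiset.
From mathcomp Require Import all_classical all_reals ereal.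

Import Order.TTheory GRing.Theory Num.Theory.
Local Open Scope ring_scope.

Set Implicit Arguments.
Unset Strict Implicit.
Unset Printing Implicit Defensive.

(** The image of a horizontal morphism between vertical slices of [M] has a rank
  invariant that is a restriction of the rank invariant of [M]: the image of
  [M(s, _) -> M(u, _)] has rank [rank M (s, y) (u, y')] at [y <= y']
  ([rank_im_phix]).  The meta-rank on [s, d) is such an image, for a particular
  [u]; since horizontal maps inside a cell of the critical grid are
  isomorphisms, every [u] in the last cell before [d] gives the same ranks
  ([rank_mrk]).  So, up to the choice of [u], the ranks of the modules
  [mrk M [s, d)] and the rank invariant of [M] are the same numbers.

  To conclude, a module over the line must be recovered from its ranks:
  two constructible modules with equal rank invariants are isomorphic, and the
  rank at [a <= b] counts the bars containing both [a] and [b].  Both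
  follow from one induction ([common_decomposition]).  Let [b] be the first
  critical value where the module is nonzero and [c] the last critical value
  such that [M b -> M c] is nonzero.  A vector of [M b] that survives in [M c]
  spans a copy of the interval module on [b, d), where [d] is the critical
  value after [c], and this copy is a retract ([split_interval]).  The interval
  is read off from the ranks, so two modules with the same ranks split off the
  same interval, the complements again have the same ranks, and the total
  dimension at the critical values has dropped.

  Two bimodules may be constructible for different critical sets, so they are
  compared over the union of the two sets. *)

Local Notation pmap := Defs.pmap.

(** * Linear maps and their ranks *)

Section LinearAlgebra.
Context (k : fieldType).
Implicit Types U V W : vectType k.

Lemma hom_of_linear U V (f : U -> V) : linear f -> {g : 'Hom(U, V) | g =1 f}.
Proof.
move=> lin_f; pose F := GRing.isLinear.Build k U V *:%R f lin_f.
pose F' : {linear U -> V} := HB.pack f F.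
by exists (linfun F') => x; rewrite lfunE.
Qed.

Lemma limg_comp_leq_l U V W (g : 'Hom(V, W)) (f : 'Hom(U, V)) :
  (\dim (limg (g \o f)) <= \dim (limg g))%N.
Proof. by apply/dimvS; rewrite limg_comp limgS ?subvf. Qed.

Lemma limg_comp_leq_r U V W (g : 'Hom(V, W)) (f : 'Hom(U, V)) :
  (\dim (limg (g \o f)) <= \dim (limg f))%N.
Proof. by rewrite limg_comp -[X in (_ <= X)%N](limg_ker_dim g) leq_addl. Qed.

Lemma dim0_eq U : \dim {: U} = 0%N -> forall u v : U, u = v.
Proof.
move=> U0; have z (u : U) : u = 0.
  apply/eqP; rewrite -memv0 (_ : 0%VS = fullv) ?memvf //.
  by apply/esym/eqP; rewrite -dimv_eq0 U0.
by move=> u v; rewrite (z u) (z v).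
Qed.

Lemma dim0_hom_l U V : \dim {: U} = 0%N -> forall f g : 'Hom(U, V), f = g.
Proof.
by move=> U0 f g; apply/lfunP => u; rewrite (dim0_eq U0 u 0) !linear0.
Qed.

Lemma dim0_hom_r U V : \dim {: V} = 0%N -> forall f g : 'Hom(U, V), f = g.
Proof. by move=> V0 f g; apply/lfunP => u; exact: dim0_eq. Qed.

Lemma rank0_eq0 U V (f : 'Hom(U, V)) : \dim (limg f) = 0%N -> f = 0.
Proof.
move/eqP; rewrite dimv_eq0 => /eqP f0; apply/lfunP => u; apply/eqP.
by rewrite zero_lfunE -memv0 -f0 memv_img ?memvf.
Qed.

Lemma dim_limg_pair U V U' V' (f : 'Hom(U, U')) (g : 'Hom(V, V')) :
  \dim (limg (linfun (pair_fun f g))) = (\dim (limg f) + \dim (limg g))%N.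
Proof.
have [i iE] : {i : 'Hom(U', (U' * V')%type) | i =1 fun u => (u, 0)}.
  by apply: hom_of_linear => a u v; congr pair; rewrite /= scaler0 addr0.
have [j jE] : {j : 'Hom(V', (U' * V')%type) | j =1 fun v => (0, v)}.
  by apply: hom_of_linear => a u v; congr pair; rewrite /= scaler0 addr0.
have -> : limg (linfun (pair_fun f g)) = (i @: limg f + j @: limg g)%VS.
  apply/eqP; rewrite eqEsubv; apply/andP; split; apply/subvP => w.
    move=> /memv_imgP[[u v] _ ->]; rewrite lfunE /= /pair_fun /=.
    have -> : (f u, g v) = i (f u) + j (g v) :> (U' * V')%type.
      by rewrite iE jE; congr pair; rewrite /= ?addr0 ?add0r.
    by rewrite memv_add ?memv_img ?memvf.
  move=> /memv_addP[_ /memv_imgP[_ /memv_imgP[u _ ->] ->]].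
  move=> [_ /memv_imgP[_ /memv_imgP[v _ ->] ->] ->].
  have -> : i (f u) + j (g v) = linfun (pair_fun f g) (u, v).
    rewrite iE jE lfunE.
    by congr pair; rewrite /= ?addr0 ?add0r.
  by rewrite memv_img ?memvf.
have inj_dim (A B : vectType k) (h : 'Hom(A, B)) (X : {vspace A}) :
    injective h -> \dim (h @: X) = \dim X.
  by move=> /lker0P/eqP h0; apply: limg_dim_eq; rewrite h0 capv0.
rewrite dimv_disjoint_sum; last first.
  apply/eqP; rewrite -subv0; apply/subvP => w; rewrite memv_cap.
  move=> /andP[/memv_imgP[u _ ->] /memv_imgP[v _]]; rewrite iE jE => -[-> _].
  by rewrite memv0.
by rewrite (inj_dim _ _ i) ?(inj_dim _ _ j) // => x y; rewrite ?iE ?jE => -[].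
Qed.

Lemma lfun_isoP U V (f : 'Hom(U, V)) : lfun_iso f ->
  [/\ injective f, (f^-1 \o f = \1)%VF & (f \o f^-1 = \1)%VF].
Proof.
move=> f_iso; have f_inj := lfun_iso_inj f_iso.
have fK : (f^-1 \o f = \1)%VF by exact/lker0_compVf/lker0P.
split=> //; have [g [_ fg]] := f_iso.
by rewrite -[LHS]comp_lfun1r -fg comp_lfunA -(comp_lfunA f) fK comp_lfun1r.
Qed.

Lemma rank_comp_iso_l U V W (g : 'Hom(V, W)) (f : 'Hom(U, V)) :
  lfun_iso g -> \dim (limg (g \o f)) = \dim (limg f).
Proof.
case=> [g' [g'g _]]; apply/eqP; rewrite eqn_leq limg_comp_leq_r /=.
rewrite -[X in (\dim (limg X) <= _)%N]comp_lfun1l -g'g -comp_lfunA.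
exact: limg_comp_leq_r.
Qed.

Lemma dim0_lfun_iso (U V : vectType k) (f : 'Hom(U, V)) :
  \dim {: U} = 0%N -> \dim {: V} = 0%N -> lfun_iso f.
Proof. by move=> U0 V0; exists 0; split; exact: dim0_hom_l. Qed.

Lemma lfun_iso_dim (U V : vectType k) (f : 'Hom(U, V)) :
  lfun_iso f -> \dim {: U} = \dim {: V}.
Proof.
move=> f_iso; have [_ _ fg] := lfun_isoP f_iso.
rewrite -(lim1g {: U}) -(rank_comp_iso_l \1%VF f_iso) comp_lfun1r.
apply/eqP; rewrite eqn_leq dimvS ?subvf //= -(lim1g {: V}) -fg.
exact: limg_comp_leq_l.
Qed.

(** A vector of [U] with nonzero image and a functional of value 1 on that image
  factor the identity of a line through [f].  The line is written as the space
  of rows of length [true], so that it is a value of an interval module. *)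
Lemma nonzero_retract (U V : vectType k) (f : 'Hom(U, V)) :
  \dim (limg f) != 0%N ->
  exists (i : 'Hom('rV[k]_true, U)) (l : 'Hom(V, 'rV[k]_true)),
    (l \o f \o i = \1)%VF.
Proof.
rewrite dimv_eq0 -vpick0 => w0.
have /memv_imgP[v _ wE] := memv_pick (limg f).
have [i iE] : {i : 'Hom('rV[k]_true, U) | i =1 fun u => u 0 0 *: v}.
  by apply: hom_of_linear => a u u'; rewrite !mxE scalerDl scalerA.
exists i, (f \o i)^-1%VF; rewrite -comp_lfunA lker0_compVf //.
apply/lker0P => u u'; rewrite !comp_lfunE !iE !linearZ /= -wE => uu.
apply/rowP => j; rewrite ord1; apply: contraNeq w0 => u0.
have /eqP := uu; rewrite -subr_eq0 -scalerBl scaler_eq0 subr_eq0 (negbTE u0).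
by [].
Qed.

End LinearAlgebra.

(** * Isomorphisms, direct sums and retracts of persistence modules *)

Section PersistenceModules.
Context (k : fieldType) (d : Order.disp_t) (P : porderType d).
Implicit Types M N A B : pmod k P.

(** The pointwise inverse of a natural transformation is natural. *)
Lemma pmod_iso_of_bij M N (f : pmor M N) :
  (forall p, lfun_iso (f p)) -> pmod_iso M N.
Proof.
move=> f_iso; pose g p := (f p)^-1%VF.
have g_nat p q (h : (p <= q)%O) : (g q \o pmap N h = pmap M h \o g p)%VF.
  have [_ fqK _] := lfun_isoP (f_iso q); have [_ _ fpK] := lfun_isoP (f_iso p).
  rewrite -[LHS]comp_lfun1r -fpK comp_lfunA -(comp_lfunA _ (pmap N h)) -pmor_nat.
  by rewrite (comp_lfunA _ (f q)) fqK comp_lfun1l.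
exists f, (PMor g_nat) => p /=.
by have [_ fK Kf] := lfun_isoP (f_iso p).
Qed.

Definition id_pmor M : pmor M M.
Proof.
by exists (fun p => \1%VF) => p q h; rewrite comp_lfun1l comp_lfun1r.
Defined.

Definition comp_pmor A B M (g : pmor B M) (f : pmor A B) : pmor A M.
Proof.
exists (fun p => (g p \o f p)%VF) => p q h.
by rewrite -comp_lfunA pmor_nat comp_lfunA pmor_nat comp_lfunA.
Defined.

Lemma pmod_iso_refl M : pmod_iso M M.
Proof. by exists (id_pmor M), (id_pmor M) => p; rewrite /= comp_lfun1l. Qed.

Lemma pmod_iso_sym M N : pmod_iso M N -> pmod_iso N M.
Proof. by move=> [f [g fg]]; exists g, f => p; have [] := fg p. Qed.

Lemma pmod_iso_trans A B M : pmod_iso A B -> pmod_iso B M -> pmod_iso A M.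
Proof.
move=> [f [g fg]] [f' [g' fg']].
exists (comp_pmor f' f), (comp_pmor g g') => p /=.
have [gf fg0] := fg p; have [gf' fg0'] := fg' p; split.
  by rewrite comp_lfunA -(comp_lfunA (g p)) gf' comp_lfun1r.
by rewrite comp_lfunA -(comp_lfunA (f' p)) fg0 comp_lfun1r.
Qed.

Lemma pmod_iso_rank M N : pmod_iso M N ->
  forall a b (h : (a <= b)%O), rank M h = rank N h.
Proof.
suff le_rank A B : pmod_iso A B -> forall a b (h : (a <= b)%O),
    (rank A h <= rank B h)%N.
  move=> MN a b h; apply/eqP; rewrite eqn_leq !le_rank //.
  exact: pmod_iso_sym.
move=> [f [g fg]] a b h; rewrite /rank.
have -> : pmap A h = (g b \o (pmap B h \o f a))%VF.
  by rewrite -pmor_nat comp_lfunA (fg b).1 comp_lfun1l.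
exact: leq_trans (limg_comp_leq_r _ _) (limg_comp_leq_l _ _).
Qed.


Lemma rank_dsum M N a b (h : (a <= b)%O) :
  rank (dsum_pmod M N) h = (rank M h + rank N h)%N.
Proof. exact: dim_limg_pair. Qed.

Lemma rank_id M a (h : (a <= a)%O) : rank M h = \dim {: M a}.
Proof. by rewrite /rank pmap_id lim1g. Qed.

Lemma dim0_rank0 M a b (h : (a <= b)%O) : \dim {: M a} = 0%N -> rank M h = 0%N.
Proof.
move=> a0; apply/eqP; rewrite -leqn0 -a0.
by rewrite -[X in (_ <= X)%N](limg_ker_dim (pmap M h)) leq_addl.
Qed.

Lemma zero_pmod_iso M :
  (forall p, \dim {: M p} = 0%N) -> pmod_iso M (zero_pmod k P).
Proof.
move=> M0; have f_nat p q (h : (p <= q)%O) :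
    ((0 : 'Hom(M q, zero_pmod k P q)) \o pmap M h =
     pmap (zero_pmod k P) h \o 0)%VF.
  by apply: dim0_hom_l.
apply: (@pmod_iso_of_bij _ _ (PMor f_nat)) => p; exists 0; split.
  exact: dim0_hom_l.
by apply: dim0_hom_l; rewrite dimvf dim_matrix.
Qed.

Lemma dsum_pmod_iso A M N :
  pmod_iso M N -> pmod_iso (dsum_pmod A M) (dsum_pmod A N).
Proof.
move=> [f [g fg]].
have F_nat (X Y : pmod k P) (f0 : pmor X Y) p q (h : (p <= q)%O) :
    (linfun (pair_fun \1%VF (f0 q)) \o pmap (dsum_pmod A X) h =
     pmap (dsum_pmod A Y) h \o linfun (pair_fun \1%VF (f0 p)))%VF.
  apply/lfunP => -[u v]; rewrite !comp_lfunE !lfunE /= /pair_fun /= ?lfunE /=.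
  by congr pair; rewrite -!comp_lfunE pmor_nat.
pose F X Y (f0 : pmor X Y) := @PMor k d P (dsum_pmod A X) (dsum_pmod A Y)
  (fun p => linfun (pair_fun \1%VF (f0 p))) (F_nat X Y f0).
exists (F _ _ f), (F _ _ g) => p; have [gf fg0] := fg p.
by split; apply/lfunP => -[u v];
   rewrite comp_lfunE !lfunE /= /pair_fun /= !lfunE /=;
   rewrite -comp_lfunE ?gf ?fg0 lfunE.
Qed.

(** Exchanges of two consecutive summands generate all reorderings of a direct
  sum of a list of modules. *)
Lemma dsum_swap A B M :
  {f : pmor (dsum_pmod A (dsum_pmod B M)) (dsum_pmod B (dsum_pmod A M)) |
    forall p w, f p w = (w.2.1, (w.1, w.2.2))}.
Proof.
have H p : {f : 'Hom(dsum_pmod A (dsum_pmod B M) p,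
                     dsum_pmod B (dsum_pmod A M) p)
    | f =1 fun w => (w.2.1, (w.1, w.2.2))} by apply: hom_of_linear.
pose f p := sval (H p); have fE p : f p =1 _ := svalP (H p).
have f_nat p q (h : (p <= q)%O) : (f q \o pmap _ h = pmap _ h \o f p)%VF.
  apply/lfunP => w; rewrite !comp_lfunE !fE.
  by rewrite !lfunE /= /pair_fun /= !lfunE.
by exists (PMor f_nat) => p w; rewrite /= fE.
Qed.

Lemma dsum_pmodCA A B M :
  pmod_iso (dsum_pmod A (dsum_pmod B M)) (dsum_pmod B (dsum_pmod A M)).
Proof.
have [f fE] := dsum_swap A B M; have [g gE] := dsum_swap B A M.
exists f, g => p; split; apply/lfunP => -[u [v w]].
  by rewrite comp_lfunE fE gE lfunE.
by rewrite comp_lfunE gE fE lfunE.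
Qed.

(** The complement of a retract is the image of the idempotent [1 - i r]; using
  an image makes constructibility of the complement a case of [im_tame]. *)
Lemma split_iso A M (i : pmor A M) (r : pmor M A) :
  (forall p, r p \o i p = \1)%VF ->
  exists e : pmor M M, pmod_iso M (dsum_pmod A (im_pmod e)).
Proof.
move=> ri; pose e p : 'Hom(M p, M p) := (\1 - (i p \o r p))%VF.
have e_nat p q (h : (p <= q)%O) : (e q \o pmap M h = pmap M h \o e p)%VF.
  rewrite /e comp_lfunDl comp_lfunDr comp_lfun1l comp_lfun1r.
  by rewrite comp_lfunNl comp_lfunNr -comp_lfunA pmor_nat !comp_lfunA pmor_nat.
exists (PMor e_nat); apply: pmod_iso_sym.
set E := im_pmod _.
have mapE p q (h : (p <= q)%O) (w : E p) :
    vsval (pmap E h w) = pmap M h (vsval w) by exact: im_mapE.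
have H p : {G : 'Hom(dsum_pmod A E p, M p) | G =1 fun w => i p w.1 + vsval w.2}.
  apply: hom_of_linear => a u v /=.
  by rewrite !linearP /= scalerDr addrACA.
pose G p := sval (H p); have GE p w : G p w = i p w.1 + vsval w.2.
  by rewrite /G; case: (H p).
have G_nat p q (h : (p <= q)%O) :
    (G q \o pmap (dsum_pmod A E) h = pmap M h \o G p)%VF.
  apply/lfunP => -[u w].
  rewrite !comp_lfunE !GE lfunE /= /pair_fun /= mapE linearD /=.
  by rewrite -(comp_lfunE (i q)) pmor_nat comp_lfunE.
have re p x : r p (e p x) = 0.
  rewrite /e -comp_lfunE comp_lfunDr comp_lfunNr comp_lfunA ri.
  by rewrite comp_lfun1l comp_lfun1r subrr lfunE.
have rE p (w : E p) : r p (vsval w) = 0.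
  by have /memv_imgP[x _ ->] := subvsP w.
have rK p u : r p (i p u) = u by rewrite -comp_lfunE ri lfunE.
apply: (@pmod_iso_of_bij _ _ (PMor G_nat)) => p /=.
apply: lfun_iso_bij => [[u w] [u' w']|x].
  rewrite !GE /= => uw.
  have uu : u = u' by have := congr1 (r p) uw; rewrite !linearD /= !rE !addr0 !rK.
  by move: uw; rewrite uu => /addrI/val_inj ->.
exists (r p x, vsproj _ (e p x)); rewrite GE /= vsprojK ?memv_img ?memvf //.
by rewrite /e add_lfunE opp_lfunE comp_lfunE id_lfunE addrC subrK.
Qed.

End PersistenceModules.

(** * Cells of a critical set *)

Section CriticalValues.
Context (R : realType) (S : critset R).
Implicit Types (a b c s t : R).

(** Comparisons with the minimum become conditions on each critical value: for
  [t <= u], the inequality [u < Sbar_gt S t] says that no critical value [s]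
  satisfies [t < s <= u], that is, [t] and [u] are in the same cell. *)
Lemma Sbar_gt_geP t (e : \bar R) :
  (e <= Sbar_gt S t)%E <->
  (forall s, s \in critseq S -> t < s -> (e <= s%:E)%E).
Proof.
rewrite /Sbar_gt; elim: (critseq S) => [|x l IH]; first by rewrite big_nil leey.
rewrite big_cons; split=> [H s|H].
  rewrite inE => /orP[/eqP-> tx|sl ts].
    by move: H; rewrite tx le_min => /andP[].
  apply: (IH.1 _ s sl ts).
  by move: H; case: ifP => // _; rewrite le_min => /andP[].
have le_l : (e <= \big[Order.min/+oo]_(s <- l | (t < s)%R) s%:E)%E.
  by apply/IH => s sl; apply: H; rewrite inE sl orbT.
by case: ifP => // tx; rewrite le_min le_l andbT H ?inE ?eqxx.
Qed.

Lemma Sbar_gt_gtP t c :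
  (c%:E < Sbar_gt S t)%E <-> (forall s, s \in critseq S -> t < s -> c < s).
Proof.
rewrite /Sbar_gt; elim: (critseq S) => [|x l IH]; first by rewrite big_nil ltry.
rewrite big_cons; split=> [H s|H].
  rewrite inE => /orP[/eqP-> tx|sl ts].
    by move: H; rewrite tx lt_min lte_fin => /andP[].
  apply: (IH.1 _ s sl ts).
  by move: H; case: ifP => // _; rewrite lt_min => /andP[].
have lt_l : (c%:E < \big[Order.min/+oo]_(s <- l | (t < s)%R) s%:E)%E.
  by apply/IH => s sl; apply: H; rewrite inE sl orbT.
by case: ifP => // tx; rewrite lt_min lt_l andbT lte_fin H ?inE ?eqxx.
Qed.

Lemma max_mem (l : seq R) : l != [::] ->
  exists2 x, x \in l & forall y, y \in l -> y <= x.
Proof.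
elim: l => // x [_ _|y l IH _].
  by exists x => [|z]; rewrite inE // => /eqP->.
have [m ml mP] := IH isT; exists (Num.max x m) => [|z].
  by rewrite inE; case: (leP x m) => _; rewrite ?ml ?eqxx ?orbT.
by rewrite inE le_max => /orP[/eqP->|/mP->]; rewrite ?lexx ?orbT.
Qed.

Lemma min_mem (l : seq R) : l != [::] ->
  exists2 x, x \in l & forall y, y \in l -> x <= y.
Proof.
move=> l0; have /max_mem[_ /mapP[x xl ->] xP] : map -%R l != [::] by case: l l0.
by exists x => // y yl; rewrite -lerN2 xP // map_f.
Qed.

(** The critical value in the second case is the greatest one not above [a]. *)
Lemma below_or_in_cell a :
  (forall s, s \in critseq S -> a < s) \/
  exists2 s, s \in critseq S & s <= a /\ (a%:E < Sbar_gt S s)%E.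
Proof.
have [/eqP F0|/max_mem[s]] := boolP ([seq s <- S | s <= a] == [::]).
  left=> s sS; rewrite ltNge; apply/negP => sa.
  have : s \in [seq s <- S | s <= a] by rewrite mem_filter sa.
  by rewrite F0.
rewrite mem_filter => /andP[sa sS] sP; right; exists s => //; split=> //.
apply/Sbar_gt_gtP => r rS sr; rewrite ltNge; apply/negP => ra.
by have := sP r; rewrite mem_filter ra rS => /(_ isT); rewrite leNgt sr.
Qed.

Lemma Sbar_gt_le_crit a i : (a%:E < crit S i)%E -> (Sbar_gt S a <= crit S i)%E.
Proof.
rewrite /crit; have [iS|iS] := ltnP i (size S); last first.
  by rewrite nth_default ?size_map ?leey.
rewrite (nth_map 0) // lte_fin => ai.
by have /Sbar_gt_geP := lexx (Sbar_gt S a); apply; rewrite ?mem_nth.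
Qed.

Lemma crit0_gt a : (forall s, s \in critseq S -> a < s) -> (a%:E < crit S 0)%E.
Proof.
move=> aS; rewrite /crit; case: (critseq S) aS => [|x l] aS; first exact: ltry.
by rewrite /= lte_fin aS ?mem_head.
Qed.

Lemma cell_crit a :
  (a%:E < crit S 0)%E \/ exists2 i, (i < size S)%N &
    (crit S i <= a%:E)%E /\ (Sbar_gt S a <= crit S i.+1)%E.
Proof.
have [a0|[i iS [ia ai]]] := crit_ge0 S a; [by left|right].
by exists i => //; split=> //; exact: Sbar_gt_le_crit.
Qed.

End CriticalValues.

(** * Constructibility in terms of cells, and interval modules *)

Section Tame.
Context (k : fieldType) (R : realType).
Implicit Types (S T : critset R) (M N : pmod k R) (I : Dgm R).

(** [S]-constructibility without indices: internal maps that cross no critical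
  value are isomorphisms.  In this form it visibly passes to larger critical
  sets and to images of morphisms. *)
Definition tame S M :=
  (forall a : R, (forall s, s \in critseq S -> a < s) -> \dim {: M a} = 0%N) /\
  (forall a b (h : a <= b), (b%:E < Sbar_gt S a)%E -> lfun_iso (pmap M h)).

Lemma S_constructible_tame S M : S_constructible S M -> tame S M.
Proof.
move=> [M0 Miso]; split=> [a /crit0_gt|a b h ba]; first exact: M0.
have [a0|[i iS [ia ai]]] := cell_crit S a.
  have b0 := lt_le_trans ba (Sbar_gt_le_crit a0).
  by apply: dim0_lfun_iso; exact: M0.
by apply: (Miso i) => //; exact: lt_le_trans ba ai.
Qed.

Lemma tame_sub S T M : {subset critseq S <= critseq T} -> tame S M -> tame T M.
Proof.
move=> ST [M0 Miso]; split=> [a aT|a b h /Sbar_gt_gtP bT].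
  by apply: M0 => s /ST; exact: aT.
by apply: Miso; apply/Sbar_gt_gtP => s /ST; exact: bT.
Qed.

(** On the image, internal maps restrict those of [N], which gives injectivity,
  and lift through those of [M], which gives surjectivity. *)
Lemma im_tame S M N (f : pmor M N) : tame S M -> tame S N -> tame S (im_pmod f).
Proof.
move=> [_ Miso] [N0 Niso]; split=> [a /N0 a0|a b h ba].
  by apply/eqP; rewrite dimvf -leqn0 /= -[X in (_ <= X)%N]a0 dimvS ?subvf.
have mapE (w : im_pmod f a) : vsval (pmap (im_pmod f) h w) = pmap N h (vsval w).
  exact: im_mapE.
apply: lfun_iso_bij => [u v uv|v].
  apply/val_inj/(lfun_iso_inj (Niso _ _ h ba)).
  by rewrite -[LHS]mapE uv mapE.
have /memv_imgP[w _ vw] := subvsP v.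
have [g [_ Mg]] := Miso _ _ h ba.
exists (vsproj _ (f a (g w))); apply: val_inj.
rewrite [LHS]mapE vsprojK ?memv_img ?memvf // -comp_lfunE -pmor_nat comp_lfunE.
by rewrite -(comp_lfunE (pmap M h)) Mg lfunE.
Qed.

Lemma dim_int_pmod I a : \dim {: int_pmod k I a} = inI I a.
Proof. by rewrite dimvf dim_matrix; exact: mul1n. Qed.

Lemma rank_int_pmod I a b (h : a <= b) :
  rank (int_pmod k I) h = inI I a && inI I b.
Proof.
have [Ia|Ia] := boolP (inI I a); last first.
  by rewrite dim0_rank0 // dim_int_pmod (negbTE Ia).
have [Ib|Ib] := boolP (inI I b); last first.
  apply/eqP; rewrite -leqn0 (leq_trans (dimvS (subvf _))) //.
  by rewrite dim_int_pmod (negbTE Ib).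
have : rank (int_pmod k I) h != 0%N.
  rewrite /rank; apply/eqP => /rank0_eq0/lfunP/(_ (const_mx 1)).
  rewrite !lfunE /= => /matrixP.
  have eq1 c : inI I c -> (inI I c : nat) = 1%N by move->.
  move=> /(_ ord0 (cast_ord (esym (eq1 _ Ib)) ord0)).
  rewrite !mxE (eq_bigr (fun=> 1)) => [|j _]; last by rewrite !mxE mulr1.
  rewrite sumr_const card_ord Ia => /eqP.
  by rewrite oner_eq0.
have : (rank (int_pmod k I) h <= 1)%N.
  by rewrite (leq_trans (dimvS (subvf _))) // dim_int_pmod Ib.
by case: (rank _ _) => [|[]].
Qed.

End Tame.

(** * Splitting off an interval *)

Section Splitting.
Context (k : fieldType) (R : realType).
Implicit Types (S T : critset R) (M N : pmod k R) (I : Dgm R).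

(** The internal map when [a <= b], and zero otherwise: families of maps can then
  be defined on all of [R], with no proof of [a <= b] at hand. *)
Definition ext_map M (a b : R) : 'Hom(M a, M b) :=
  match @idP (a <= b) with ReflectT h => pmap M h | ReflectF _ => 0 end.

Lemma ext_mapE M a b (h : a <= b) : ext_map M a b = pmap M h.
Proof.
rewrite /ext_map; case: {-}_ / idP => [h'|//]; congr pmap.
exact: bool_irrelevance.
Qed.

Lemma ext_map_comp M a b c : a <= b -> b <= c ->
  (ext_map M b c \o ext_map M a b)%VF = ext_map M a c.
Proof.
move=> ab bc; rewrite (ext_mapE _ ab) (ext_mapE _ bc).
by rewrite (ext_mapE _ (le_trans ab bc)) -(pmap_comp _ _ _ (le_trans ab bc)).
Qed.

Lemma ext_map_id M a : ext_map M a a = \1%VF.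
Proof. by rewrite ext_mapE pmap_id. Qed.

(** The internal maps of interval modules, with the memberships of the two
  endpoints as parameters. *)
Definition ones_map (m n : bool) : 'Hom('rV[k]_m, 'rV[k]_n) :=
  linfun (mulmxr (const_mx 1 : 'M[k]_(m, n))).

Lemma ones_map_comp (m n p : bool) : n ->
  (ones_map n p \o ones_map m n)%VF = ones_map m p.
Proof.
case: n => // _; apply/lfunP => u; rewrite comp_lfunE !lfunE /= -mulmxA.
by congr (_ *m _); apply/matrixP => i j; rewrite !mxE big_ord1 !mxE mulr1.
Qed.

Lemma ones_map_id (m : bool) : ones_map m m = \1%VF.
Proof.
case: m; last by apply/lfunP => u; apply/rowP => -[].
apply/lfunP => u; rewrite !lfunE /= -[RHS]mulmx1; congr (_ *m _).
by apply/matrixP => i j; rewrite !mxE !ord1.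
Qed.

(** Here [I] is [b, d), and [M b -> M c] is nonzero while [M b -> M a] vanishes
  from [d] on.  Fix [i] and [l] with [l (M b -> M c) i = 1].  Pushing [i]
  forward gives a morphism from the interval module to [M], natural at [d]
  because the vector dies there.  In the other direction, on [I] a vector of
  [M a] is carried to [M c], backwards if [c < a], and evaluated by [l]; this is
  natural at [b] because [M] vanishes before [b].  The composite is the identity
  on [I]. *)
Lemma split_interval M I c (hbc : (dgmval I).1 <= c) :
  (c%:E < (dgmval I).2)%E ->
  (forall a, a < (dgmval I).1 -> \dim {: M a} = 0%N) ->
  (forall a (h : c <= a), (a%:E < (dgmval I).2)%E -> lfun_iso (pmap M h)) ->
  (forall a (h : (dgmval I).1 <= a), ((dgmval I).2 <= a%:E)%E ->
    rank M h = 0%N) ->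
  rank M hbc <> 0%N ->
  exists e : pmor M M, pmod_iso M (dsum_pmod (int_pmod k I) (im_pmod e)).
Proof.
set b := (dgmval I).1; set d := (dgmval I).2 => cd M0 Miso Md.
move=> /eqP/nonzero_retract[i [l]]; rewrite -ext_mapE => liE.
(* [M a] is compared with [M c] inside [M (m a)], which covers [a <= c] and
   [c <= a] by one formula. *)
pose m a := Num.max a c.
have am a : a <= m a by rewrite le_max lexx.
have cm a : c <= m a by rewrite le_max lexx orbT.
have inIb a : inI I a -> b <= a by case/andP.
have inId a : inI I a -> (a%:E < d)%E by case/andP.
have miso a : inI I a -> lfun_iso (ext_map M c (m a)).
  move=> Ia; rewrite (ext_mapE _ (cm a)); apply: Miso; rewrite /m.
  by case: (leP a c) => _ //; apply: inId.
pose L a : 'Hom(M a, M c) := ((ext_map M c (m a))^-1 \o ext_map M a (m a))%VF.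
have L_nat a a' : inI I a -> inI I a' -> a <= a' ->
    (L a' \o ext_map M a a' = L a)%VF.
  move=> Ia Ia' aa'; rewrite /L -comp_lfunA ext_map_comp //.
  have mm : m a <= m a' by rewrite ge_max cm (le_trans aa').
  have [_ _ Kf] := lfun_isoP (miso _ Ia).
  have [_ fK _] := lfun_isoP (miso _ Ia').
  rewrite -(ext_map_comp M (am a) mm) comp_lfunA; congr comp_lfun.
  rewrite -[LHS]comp_lfun1r -Kf comp_lfunA -(comp_lfunA _ (ext_map M (m a) _)).
  by rewrite ext_map_comp // fK comp_lfun1l.
have Ib : inI I b by rewrite /inI lexx (dgmP I).
have Ic : inI I c by rewrite /inI cd andbT.
have L_b a : inI I a -> (L a \o ext_map M b a)%VF = ext_map M b c.
  move=> Ia; rewrite L_nat ?inIb // -(L_nat b c) // /L /m maxxx ext_map_id.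
  have [] := lfun_isoP (_ : lfun_iso (\1%VF : 'Hom(M c, M c))).
    by exists \1%VF; rewrite comp_lfun1l.
  by rewrite !comp_lfun1r => _ -> _; rewrite comp_lfun1l.
clearbody L.
pose r a := (ones_map true (inI I a) \o (l \o L a))%VF.
pose s a := (ext_map M b a \o i \o ones_map (inI I a) true)%VF.
have r_nat a a' (h : (a <= a')%O) :
    (r a' \o pmap M h = pmap (int_pmod k I) h \o r a)%VF.
  have [Ia'|Ia'] := orP (orbN (inI I a')); last first.
    apply: (@dim0_hom_r _ _ (int_pmod k I a')).
    by rewrite dim_int_pmod (negbTE Ia').
  have [Ia|Ia] := orP (orbN (inI I a)); last first.
    apply/dim0_hom_l/M0; rewrite ltNge; apply: contra Ia => ba.
    by rewrite /inI ba (le_lt_trans _ (inId _ Ia')) // lee_fin.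
  rewrite -(ext_mapE M) -[pmap (int_pmod k I) _]/(ones_map _ _) /r -comp_lfunA.
  by rewrite -(comp_lfunA l) L_nat // [RHS]comp_lfunA ones_map_comp.
have s_nat a a' (h : (a <= a')%O) :
    (s a' \o pmap (int_pmod k I) h = pmap M h \o s a)%VF.
  have [Ia|Ia] := orP (orbN (inI I a)); last first.
    apply: (@dim0_hom_l _ (int_pmod k I a)).
    by rewrite dim_int_pmod (negbTE Ia).
  rewrite -(ext_mapE M) -[pmap (int_pmod k I) _]/(ones_map _ _) /s !comp_lfunA.
  have ba' := le_trans (inIb _ Ia) h.
  rewrite ext_map_comp ?inIb //.
  have [Ia'|Ia'] := orP (orbN (inI I a')).
    by rewrite -comp_lfunA ones_map_comp.
  have -> : ext_map M b a' = 0.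
    rewrite ext_mapE; apply/rank0_eq0/Md; rewrite leNgt.
    by apply: contra Ia' => a'd; rewrite /inI ba'.
  by rewrite !comp_lfun0l.
pose s_mor := @PMor k _ R (int_pmod k I) M s s_nat.
pose r_mor := @PMor k _ R M (int_pmod k I) r r_nat.
apply: (split_iso (i := s_mor) (r := r_mor)) => a /=.
have [Ia|Ia] := orP (orbN (inI I a)); last first.
  by apply: (@dim0_hom_l _ (int_pmod k I a)); rewrite dim_int_pmod (negbTE Ia).
rewrite /r /s -[LHS]comp_lfunA -[X in (_ \o X)%VF]comp_lfunA.
rewrite 2!(comp_lfunA (L a)) L_b //.
by rewrite 2!(comp_lfunA l) liE comp_lfun1l ones_map_comp // ones_map_id.
Qed.

End Splitting.

(** * The rank invariant of a module over the line is complete *)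

Section Decomposition.
Context (k : fieldType) (R : realType).
Implicit Types (S T : critset R) (M N : pmod k R) (I : Dgm R) (l : seq (Dgm R)).

(** For critical [b] and [c], these conditions describe the bar to split off: it
  starts at the first critical value with [M b != 0], and [c] is the last
  critical value where some vector of [M b] is still nonzero.  They are stated
  by ranks, so that modules of equal rank have the same leading bar. *)
Definition leading S M (b c : R) (hbc : b <= c) := [/\
  forall s, s \in critseq S -> s < b -> rank M (lexx s) = 0%N,
  rank M hbc <> 0%N &
  forall s (h : b <= s), s \in critseq S -> c < s -> rank M h = 0%N].

Lemma leading_exists S M s : s \in critseq S -> rank M (lexx s) <> 0%N ->
  exists b c (hbc : b <= c), b \in critseq S /\ leading S M hbc.
Proof.
move=> sS /eqP rs.
have /min_mem[b] : [seq x <- S | rank M (lexx x) != 0%N] != [::].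
  by rewrite -has_filter; apply/hasP; exists s.
rewrite mem_filter => /andP[rb bS] bmin.
pose alive x := (b <= x) && (ext_map M b x != 0).
have /max_mem[c] : [seq x <- S | alive x] != [::].
  rewrite -has_filter; apply/hasP; exists b => //.
  rewrite /alive lexx ext_map_id; apply: contraNneq rb => id0.
  by rewrite /rank pmap_id id0 lim0g dimv0.
rewrite mem_filter => /andP[/andP[bc rc] cS] cmax.
exists b, c, bc; split=> //; split=> [x xS xb|/rank0_eq0|x bx xS cx].
- apply/eqP; apply: contraTT xb => rx; rewrite -leNgt bmin //.
  by rewrite mem_filter rx.
- by rewrite -ext_mapE => c0; rewrite c0 eqxx in rc.
- apply/eqP; apply: contraTT cx => rx; rewrite -leNgt cmax //.
  rewrite mem_filter xS /alive bx andbT ext_mapE /=.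
  by apply: contraNneq rx => x0; rewrite /rank x0 lim0g dimv0.
Qed.

Lemma eq_leading S M N b c (hbc : b <= c) :
  (forall x y (h : x <= y), rank M h = rank N h) ->
  leading S M hbc -> leading S N hbc.
Proof.
by move=> MN [h1 h2 h3]; split=> [s sS sb||s h sS cs]; rewrite -MN; auto.
Qed.

Lemma tame_dim0 S M a : tame S M ->
  (forall s, s \in critseq S -> s <= a -> rank M (lexx s) = 0%N) ->
  \dim {: M a} = 0%N.
Proof.
move=> [M0 Miso] r0; have [/M0//|[s sS [sa a_lt]]] := below_or_in_cell S a.
by rewrite -(lfun_iso_dim (Miso _ _ sa a_lt)) -(rank_id M (lexx s)) r0.
Qed.

Lemma split_leading S M b c (hbc : b <= c) : tame S M -> leading S M hbc ->
  exists2 M', tame S M' &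
    pmod_iso M (dsum_pmod (int_pmod k (next_interval S hbc)) M').
Proof.
move=> Mt [rb rc rd].
have [||a ca ad|a ba da|//|e Me] :=
  @split_interval _ _ M (next_interval S hbc) c hbc.
- exact: Sbar_gtP.
- move=> a ab; apply: (tame_dim0 Mt) => s sS sa.
  by apply: rb => //; exact: le_lt_trans ab.
- exact: Mt.2.
- have [aS|[s sS [sa a_lt]]] := below_or_in_cell S a.
    apply: dim0_rank0; apply: (tame_dim0 Mt) => s /aS a_s sb.
    by have := le_lt_trans (le_trans sb ba) a_s; rewrite ltxx.
  have cs : c < s.
    rewrite ltNge; apply/negP => sc; move: da; rewrite leNgt => /negP; apply.
    apply/Sbar_gt_gtP => x xS cx.
    by apply: (Sbar_gt_gtP S s a).1 => //; exact: le_lt_trans cx.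
  have bs := le_trans hbc (ltW cs).
  apply/eqP; rewrite /rank (pmap_comp _ bs sa) -leqn0.
  rewrite (leq_trans (limg_comp_leq_r _ _)) //.
  by rewrite -[X in (X <= _)%N]/(rank M bs) rd.
- by exists (im_pmod e) => //; exact: im_tame.
Qed.

(** Lists rather than multisets, so that bars can be added by recursion;
  [list_barsum_perm] makes the order irrelevant. *)
Definition list_barsum l : pmod k R :=
  foldr (fun I => dsum_pmod (int_pmod k I)) (zero_pmod k R) l.

Lemma rank_list_barsum l a b (h : a <= b) :
  rank (list_barsum l) h = count (fun I => inI I a && inI I b) l.
Proof.
elim: l => [|I l IH] /=; last by rewrite rank_dsum rank_int_pmod IH.
apply/eqP; rewrite -leqn0 (leq_trans (dimvS (subvf _))) //.
by rewrite dimvf dim_matrix.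
Qed.

(** Decomposing two modules of equal rank simultaneously yields the existence of
  barcodes (for [M = N]) and the completeness of the rank at once.  The
  induction is on the total dimension at the critical values. *)
Lemma common_decomposition S M N : tame S M -> tame S N ->
  (forall a b (h : a <= b), rank M h = rank N h) ->
  exists l, pmod_iso M (list_barsum l) /\ pmod_iso N (list_barsum l).
Proof.
have [n] := ubnP (\sum_(s <- S) rank M (lexx s))%N.
elim: n M N => // n IH M N Mn Mt Nt MN.
have [/hasP[s sS /eqP rs]|/hasPn r0] :=
  boolP (has (fun s => rank M (lexx s) != 0%N) S); last first.
  exists [::]; split; apply: zero_pmod_iso => a.
    by apply: (tame_dim0 Mt) => s /r0/negPn/eqP.
  by apply: (tame_dim0 Nt) => s /r0/negPn/eqP; rewrite MN.
have [b [c [hbc [bS Ml]]]] := leading_exists sS rs.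
have Nl := eq_leading MN Ml; set I := next_interval S hbc.
have [M' M't MM'] := split_leading Mt Ml.
have [N' N't NN'] := split_leading Nt Nl.
have rM a a' (h : a <= a') : rank M h = (rank (int_pmod k I) h + rank M' h)%N.
  by rewrite -rank_dsum; exact: pmod_iso_rank.
have rN a a' (h : a <= a') : rank N h = (rank (int_pmod k I) h + rank N' h)%N.
  by rewrite -rank_dsum; exact: pmod_iso_rank.
have [|//|//||l [M'l N'l]] := IH M' N'.
- rewrite (leq_trans _ (Mn : (_ <= n)%N)) //.
  rewrite (eq_bigr _ (fun s _ => rM s s (lexx s))).
  rewrite big_split /= -[X in (X < _)%N]add0n ltn_add2r.
  rewrite (big_rem b bS) /= rank_int_pmod andbb.
  by rewrite /inI lexx /= (le_lt_trans _ (Sbar_gtP S c)) ?lee_fin.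
- by move=> a a' h; have := MN _ _ h; rewrite rM rN => /addnI.
exists (I :: l); split.
  by apply: pmod_iso_trans MM' _; exact: dsum_pmod_iso.
by apply: pmod_iso_trans NN' _; exact: dsum_pmod_iso.
Qed.

Lemma list_barsum_mid I l1 l2 :
  pmod_iso (list_barsum (I :: l1 ++ l2)) (list_barsum (l1 ++ I :: l2)).
Proof.
elim: l1 => [|J l1 IH] /=; first exact: pmod_iso_refl.
apply: pmod_iso_trans (dsum_pmodCA _ _ _) _; exact: dsum_pmod_iso.
Qed.

Lemma list_barsum_perm l l' : perm_eq l l' ->
  pmod_iso (list_barsum l) (list_barsum l').
Proof.
elim: l l' => [|I l IH] l' ll'.
  have /perm_nilP-> : perm_eq l' [::] by rewrite perm_sym.
  exact: pmod_iso_refl.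
have Il' : I \in l' by rewrite -(perm_mem ll') mem_head.
move: ll'; case/path.splitPr: Il' => l1 l2.
rewrite -[_ ++ _ :: _]/(_ ++ [:: _] ++ _) perm_sym perm_catCA /=.
rewrite perm_cons perm_sym => ll'.
apply: pmod_iso_trans (list_barsum_mid _ _ _).
by apply: dsum_pmod_iso; exact: IH.
Qed.

Fact union_critset_sorted S T : sorted <%R (sort <=%R (undup (S ++ T))).
Proof. by rewrite sort_lt_sorted undup_uniq. Qed.

Fact union_critset_neq0 S T : sort <=%R (undup (S ++ T)) != [::].
Proof.
have [x xS _] := max_mem (crit_neq0 S).
apply/eqP => /(congr1 (fun e : seq R => x \in e)).
by rewrite mem_sort mem_undup mem_cat xS.
Qed.

Definition union_critset S T :=
  Critset (union_critset_sorted S T) (union_critset_neq0 S T).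

Lemma mem_union_critset S T x :
  (x \in critseq (union_critset S T)) = (x \in critseq S) || (x \in critseq T).
Proof. by rewrite mem_sort mem_undup mem_cat. Qed.

Lemma tame_union S T M : tame S M -> tame (union_critset S T) M.
Proof. by apply: tame_sub => x xS; rewrite mem_union_critset xS. Qed.

Lemma tame_unionr S T M : tame T M -> tame (union_critset S T) M.
Proof. by apply: tame_sub => x xS; rewrite mem_union_critset xS orbT. Qed.

(** The common decomposition is taken over the union of the critical sets. *)
Lemma iso_of_rank S T M N : S_constructible S M -> S_constructible T N ->
  (forall a b (h : a <= b), rank M h = rank N h) -> pmod_iso M N.
Proof.
move=> /S_constructible_tame/(tame_union T) Mt.
move=> /S_constructible_tame/(tame_unionr S) Nt MN.
have [l [Ml Nl]] := common_decomposition Mt Nt MN.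
exact: pmod_iso_trans Ml (pmod_iso_sym Nl).
Qed.

Lemma pvec_of_eq M N (hM : constructible M) (hN : constructible N) :
  pvec_of hM = pvec_of hN <-> pmod_iso M N.
Proof.
split=> [/(congr1 (fun C => pvec_set C N)) /= |MN].
  by rewrite /iso_class => ->; exact: pmod_iso_refl.
rewrite /pvec_of; move: (ex_intro _ M _) (ex_intro _ N _).
have -> : iso_class M = iso_class N.
  apply/funext => X; apply/propext; split; apply: pmod_iso_trans => //.
  exact: pmod_iso_sym.
by move=> p q; rewrite (Prop_irrelevance p q).
Qed.

(** The barcode is chosen among all decompositions of [M], and the count is the
  rank of the direct sum of bars for each of them. *)
Lemma rank_barc M (hM : constructible M) a b (h : a <= b) :
  rank M h =
  count (fun I => inI I a && inI I b) (enum_mset (barc (pvec_of hM))).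
Proof.
have [S' /S_constructible_tame Mt] := hM.
have [l [Ml _]] := common_decomposition Mt Mt (fun _ _ _ => erefl).
have ex : pvec_set (pvec_of hM) (barsum k (seq_mset l)).
  apply: pmod_iso_trans Ml _; apply: list_barsum_perm.
  by rewrite perm_sym perm_eq_seq_mset.
rewrite -rank_list_barsum; apply: pmod_iso_rank.
have barsum_ex : exists B, pvec_set (pvec_of hM) (barsum k B).
  by exists (seq_mset l).
exact: (xgetPex mset0%mset barsum_ex).
Qed.

End Decomposition.

(** * The ranks of the meta-rank *)

Section MetaRankFromRank.
Context (k : fieldType) (R : realType).
Implicit Types (S T : critset R) (I : Dgm R).

(** The inclusion of the image in [N] preserves ranks, and takes the image of an
  internal map to the image of the composite. *)
Lemma rank_im_pmod (M N : pmod k R) (f : pmor M N) a b (h : a <= b) :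
  rank (im_pmod f) h = \dim (limg (pmap N h \o f a)).
Proof.
pose incl c : 'Hom(im_pmod f c, N c) := linfun vsval.
have inclE c w : incl c w = vsval w by rewrite lfunE.
have incl_inj c : lker (incl c) == 0%VS.
  by apply/lker0P => u v; rewrite !lfunE /= => /val_inj.
have -> : limg (pmap N h \o f a) = (incl b @: limg (pmap (im_pmod f) h))%VS.
  have -> : limg (pmap N h \o f a) = (pmap N h @: limg (incl a))%VS.
    rewrite limg_comp; congr (_ @: _)%VS; apply/eqP; rewrite eqEsubv.
    apply/andP; split; apply/subvP => u.
      move=> uf; have -> : u = incl a (vsproj _ u) by rewrite lfunE /= vsprojK.
      by rewrite memv_img ?memvf.
    by move=> /memv_imgP[v _ ->]; rewrite lfunE; exact: subvsP.
  rewrite -!limg_comp; congr (_ @: _)%VS; apply/lfunP => u.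
  by rewrite [LHS]comp_lfunE [RHS]comp_lfunE !inclE; exact/esym/im_mapE.
rewrite limg_dim_eq // ; have /eqP-> := incl_inj b; exact: capv0.
Qed.

Lemma rank_im_phix (M : bimodule k R) s t (st : s <= t) y y' (h : y <= y') :
  rank (im_pmod (phix M st)) h = rank M (pt_le st h).
Proof.
rewrite rank_im_pmod /rank.
by rewrite (pmap_comp M (pt_le st (lexx y)) (pt_le (lexx t) h) (pt_le st h)).
Qed.

Lemma pt_le2 (s y t y' : R) : (pt s y <= pt t y')%O -> y <= y'.
Proof. by rewrite leEprod => /andP[]. Qed.

Section Bimodule.
Context (S : critset R) (M : bimodule k R) (hM : S_biconstructible S M).

Lemma horizontal_iso t u y (tu : t <= u) : (u%:E < Sbar_gt S t)%E ->
  lfun_iso (pmap M (pt_le tu (lexx y))).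
Proof.
case: hM => M0 Miso ut.
have [t0|[i iS [it ti]]] := cell_crit S t.
  apply: dim0_lfun_iso; apply: M0; left => //.
  exact: lt_le_trans ut (Sbar_gt_le_crit t0).
have [y0|[j jS [jy yj]]] := cell_crit S y.
  by apply: dim0_lfun_iso; apply: M0; right.
apply: (Miso i j) => //; first exact: lt_le_trans ut ti.
exact: lt_le_trans (Sbar_gtP S y) yj.
Qed.

Lemma rank_same_cell s t u y y' (st : s <= t) (su : s <= u) (h : y <= y') :
  (u%:E < Sbar_gt S t)%E -> (t%:E < Sbar_gt S u)%E ->
  rank M (pt_le st h) = rank M (pt_le su h).
Proof.
wlog tu : t u st su / t <= u.
  by move=> H ut tu; have [/H|/ltW/H] := leP t u; [apply|move=> <-].
move=> ut _; rewrite /rank.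
rewrite (pmap_comp _ (pt_le st h) (pt_le tu (lexx y')) (pt_le su h)).
by rewrite rank_comp_iso_l //; exact: horizontal_iso.
Qed.

End Bimodule.

Lemma crit_le_nth S (x : R) j : x \in critseq S -> (j < size S)%N ->
  (x <= nth 0 S j) = (index x S <= j)%N.
Proof.
move=> xS jS; rewrite -{1}(nth_index 0 xS).
by rewrite (lt_sorted_leq_nth 0 (crit_sorted S)) // inE index_mem.
Qed.

(** The point [u] lies in the last cell before the end [d] of [I].  The point
  [mrk_end S I] lies in the same cell: before [d] and at or after the previous
  critical value when [d] is critical, at [d] itself when [d] is a noncritical
  real number, and at or after all critical values when [d] is infinite. *)
Lemma mrk_end_same_cell S I (u : R) :
  (dgmval I).1 <= u -> (u%:E < (dgmval I).2)%E ->
  ((dgmval I).2 <= Sbar_gt S u)%E ->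
  ((mrk_end S I)%:E < Sbar_gt S u)%E /\ (u%:E < Sbar_gt S (mrk_end S I))%E.
Proof.
rewrite /mrk_end; case: I => -[s [t| |]] //= st su ut tu.
  rewrite !lte_fin in st ut; have tP := (Sbar_gt_geP S u t%:E).1 tu.
  have [tS|tS] := boolP (t \in critseq S); last first.
    split; apply/Sbar_gt_gtP => x xS.
      move=> /(tP x xS); rewrite lee_fin le_eqVlt => /orP[/eqP tx|//].
      by rewrite tx xS in tS.
    exact: lt_trans.
  set i := index t S; have tn : nth 0 S i = t by rewrite nth_index.
  have iS : (i < size S)%N by rewrite index_mem.
  have si : s < nth 0 S i by rewrite tn.
  (* [prev]: the value before [t] in [S] is at most the chosen [t - e]. *)
  have := xgetPex 0 (admissible_delta_ex iS si).
  set e := xget _ _; rewrite /admissible_delta /= tn => -[e0 [_ prev]].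
  split; apply/Sbar_gt_gtP => x xS.
    by move=> /(tP x xS); rewrite lee_fin; apply: lt_le_trans; rewrite gtrBl.
  move=> ex; apply: lt_le_trans ut _; rewrite leNgt; apply/negP => xt.
  have xi : (index x S < i)%N.
    rewrite ltnNge -(crit_le_nth (x := t)) ?index_mem //.
    by rewrite nth_index // -ltNge.
  have i0 : (0 < i)%N by exact: leq_ltn_trans xi.
  have : x <= nth 0 S i.-1.
    rewrite crit_le_nth ?(leq_ltn_trans (leq_pred _)) //.
    by rewrite -ltnS prednK.
  by move=> /le_trans/(_ (prev i0)); rewrite leNgt ex.
have u_oo := (Sbar_gt_geP S u +oo%E).1 tu.
have lastP x : x \in critseq S -> x <= Num.max s (last 0 S).
  move=> xS; rewrite le_max; apply/orP; right.
  have S0 : (0 < size S)%N by case: (critseq S) xS.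
  rewrite -nth_last crit_le_nth ?prednK //.
  by rewrite -ltnS prednK // index_mem.
split; apply/Sbar_gt_gtP => x xS; first by move=> /(u_oo x xS); rewrite leye_eq.
by rewrite ltNge lastP.
Qed.

(** The ranks of the meta-rank are values of the rank invariant of [M], and the
  choice of [u] is free, so one [u] can serve two critical sets. *)
Lemma rank_mrk S (M : bimodule k R) (hM : S_biconstructible S M) I u y y'
    (h : y <= y') (su : (dgmval I).1 <= u) :
  (u%:E < (dgmval I).2)%E -> ((dgmval I).2 <= Sbar_gt S u)%E ->
  rank (im_pmod (phix M (mrk_end_ge S I))) h = rank M (pt_le su h).
Proof.
move=> ud dS; have [eu ue] := mrk_end_same_cell su ud dS.
by rewrite rank_im_phix; exact: (rank_same_cell hM).
Qed.

(** The witness is the greatest among the start of [I] and the critical values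
  before its end. *)
Lemma exists_in_last_cell S I : exists u, [/\ (dgmval I).1 <= u,
  (u%:E < (dgmval I).2)%E & ((dgmval I).2 <= Sbar_gt S u)%E].
Proof.
case: I => -[s d] /= sd.
have [|u] := @max_mem R (s :: [seq x <- S | (x%:E < d)%E]); first by [].
rewrite inE mem_filter => uP umax; exists u; split.
- by rewrite umax ?mem_head.
- by case/orP: uP => [/eqP->|/andP[]].
- apply/Sbar_gt_geP => x xS ux; rewrite leNgt; apply/negP => xd.
  by move: ux; rewrite ltNge umax // inE mem_filter xd xS orbT.
Qed.

End MetaRankFromRank.

Lemma Sbar_gt_union (R : realType) (S T : critset R) u :
  (Sbar_gt (union_critset S T) u <= Sbar_gt S u)%E /\
  (Sbar_gt (union_critset S T) u <= Sbar_gt T u)%E.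
Proof.
have H := (Sbar_gt_geP (union_critset S T) u _).1 (lexx _).
by split; apply/Sbar_gt_geP => s sS; apply: H;
   rewrite mem_union_critset sS ?orbT.
Qed.

Theorem proposition12 (k : fieldType) (R : realType) (S : critset R)
    (M : bimodule k R) (hM : S_biconstructible S M) :
  (forall (T : critset R) (N : bimodule k R) (hN : S_biconstructible T N),
     @rank k _ _ M = @rank k _ _ N <-> mrk hM = mrk hN) /\
  (forall (s y t y' : R) (h : (pt s y <= pt t y')%O),
     rank M h =
     count (fun I : Dgm R => ((dgmval I).1 <= y) && (y <= y')
                             && (y'%:E < (dgmval I).2)%E)
       (enum_mset (barc (mrk hM (next_interval S (pt_le1 h)))))).
Proof.
split=> [T N hN|s y t y' h].
  split=> [MN|MN].
    apply/funext => I; apply/pvec_of_eq.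
    apply: (iso_of_rank (im_phix_constructible hM _)
                        (im_phix_constructible hN _)).
    move=> y y' h.
    have [u [su ud dU]] := exists_in_last_cell (union_critset S T) I.
    have [US UT] := Sbar_gt_union S T u.
    rewrite (rank_mrk hM h su ud (le_trans dU US)).
    by rewrite (rank_mrk hN h su ud (le_trans dU UT)) MN.
  apply: functional_extensionality_dep => -[s y].
  apply: functional_extensionality_dep => -[t y']; apply/funext => h.
  have st := pt_le1 h; have yy' := pt_le2 h.
  (* For the union, [t] lies in the last cell of [I] for both critical sets. *)
  pose I := next_interval (union_critset S T) st.
  have [US UT] := Sbar_gt_union S T t.
  have ud : (t%:E < (dgmval I).2)%E by exact: Sbar_gtP.
  have := rank_mrk hM (I := I) yy' st ud US.
  have := rank_mrk hN (I := I) yy' st ud UT.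
  rewrite (pmod_iso_rank ((pvec_of_eq _ _).1 (congr1 (fun f => f I) MN))) => ->.
  by rewrite (bool_irrelevance (pt_le st yy') h) => ->.
set I := next_interval S _; have yy' := pt_le2 h.
rewrite (bool_irrelevance h (pt_le (pt_le1 h) yy')).
rewrite -(@rank_mrk _ _ _ _ hM I) ?lexx //; last exact: Sbar_gtP.
have im_c : constructible (im_pmod (phix M (mrk_end_ge S I))).
  by exists S; exact: im_phix_constructible.
rewrite (rank_barc im_c) (_ : pvec_of im_c = mrk hM I); last first.
  exact/pvec_of_eq/pmod_iso_refl.
apply: eq_count => J; rewrite /inI yy' andbT.
by apply/andP/andP => [[/andP[Jy _] /andP[_ ->]]|[Jy y'J]]; rewrite ?Jy ?y'J //=
  ?(le_trans Jy yy') ?(le_lt_trans _ y'J) ?lee_fin.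
Qed.
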